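(* Let $H$ be a complex Hilbert space and let $T\in B(H)$ be a rank one operator with $\operatorname{tr}T=0$. The following are equivalent: (i) $\mathcal S(T,T^* )$ is an SI semigroup. (ii) $\|T\|=1$. (iii) $\mathcal S(T,T^* )$ is a simple semigroup.
   Context: $H$ may be finite or infinite dimensional; $B(H)$ is the set of bounded linear operators on $H$. A semigroup $\mathcal S\subset B(H)$ is a subset closed under multiplication. $\mathcal S(T,T^* )$ is the semigroup generated by $\{T,T^*\}$, i.e. the set of all finite nonempty words in $T$ and $T^*$. An ideal $J$ of a semigroup $\mathcal S$ is a (two-sided) multiplicative ideal: a subset $J\subset\mathcal S$ with $XA, AX\in J$ for all $A\in J$, $X\in\mathcal S$ (no closure under sums or scalars is required). $\mathcal S$ is a selfadjoint-ideal (SI) semigroup if every ideal $J$ of $\mathcal S$ satisfies $\{A^*: A\in J\}\subset J$. $\mathcal S$ is simple if its only nonzero ideal (i.e. ideal containing a nonzero operator) is $\mathcal S$ itself; $\mathcal S$ may contain $0$, so that $\{0\}$ being an ideal does not prevent simplicity. $\operatorname{tr}$ denotes the trace and $\|\cdot\|$ the operator norm. *)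

(* Defs.v *)
From HB Require Import structures.
From mathcomp Require Import all_boot all_order all_algebra.
From mathcomp Require Import complex.
From mathcomp Require Import all_classical all_reals all_analysis.

Set Implicit Arguments.
Unset Strict Implicit.
Unset Printing Implicit Defensive.

Import Order.TTheory GRing.Theory Num.Theory.
Import numFieldNormedType.Exports.

Local Open Scope classical_set_scope.
Local Open Scope ring_scope.
Local Open Scope complex_scope.

(* The norm of H takes its (nonnegative real) values in R[i]; the inner product
   is linear in its first argument and conjugate-linear in the second. *)
HB.mixin Record CompleteNormedModule_isHilbert (R : realType) H
    of CompleteNormedModule R[i] H := {
  inner : {dot H for (@Num.conj R[i])} ;
  inner_norm : forall x : H, inner x x = `|x| ^+ 2 }.

#[short(type="hilbertType")]
HB.structure Definition Hilbert (R : realType) :=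
  {H of CompleteNormedModule_isHilbert R H & CompleteNormedModule R[i] H}.

Section operators.
Variables (R : realType) (H : hilbertType R).
Implicit Types (A T : H -> H) (E : set H) (S J G : set (H -> H)).

Definition bounded_op : set (H -> H) :=
  [set T | linear T /\ exists M : R[i], forall x : H, `|T x| <= M * `|x|].

Definition opnorm T : R :=
  sup [set complex.Re `|T x| | x in [set x : H | `|x| <= 1]].

(* For bounded T such an operator exists and is unique (Riesz), so the choice
   made by [get] is forced. *)
Definition adjoint T : H -> H :=
  get [set A | bounded_op A /\ forall x y : H, inner (T x) y = inner x (A y)].

Definition rank_one T : Prop :=
  exists2 u : H, u != 0 & range T = [set c *: u | c in [set: R[i]]].

Definition orthonormal_set E : Prop :=
  (forall e, E e -> inner e e = 1) /\
  (forall e f, E e -> E f -> e != f -> inner e f = 0).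

Definition orthonormal_basis E : Prop :=
  orthonormal_set E /\
  forall E', orthonormal_set E' -> E `<=` E' -> E' = E.

(* Unconditional summation: convergence of the net of finite partial sums
   (H need not be separable, so E may be uncountable). *)
Definition sums_to E (a : H -> R[i]) (t : R[i]) : Prop :=
  forall eps : R[i], 0 < eps ->
  exists F0, [/\ finite_set F0, F0 `<=` E &
    forall F, finite_set F -> F0 `<=` F -> F `<=` E ->
      `|\sum_(e \in F) a e - t| < eps].

Definition has_trace T (t : R[i]) : Prop :=
  forall E, orthonormal_basis E -> sums_to E (fun e => inner (T e) e) t.

Inductive generated_semigroup G : set (H -> H) :=
| gen_base A : G A -> generated_semigroup G A
| gen_comp A B : generated_semigroup G A -> generated_semigroup G B ->
    generated_semigroup G (A \o B).

Definition ideal S J : Prop :=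
  J `<=` S /\ forall A X, J A -> S X -> J (X \o A) /\ J (A \o X).

Definition SI_semigroup S : Prop :=
  forall J, ideal S J -> adjoint @` J `<=` J.

Definition simple_semigroup S : Prop :=
  forall J, ideal S J -> (exists2 A, J A & A <> (fun=> 0)) -> J = S.

End operators.

(* Main.v *)
From HB Require Import structures.
Require Import Defs.
From mathcomp Require Import all_boot all_order all_algebra.
From mathcomp Require Import complex.
From mathcomp Require Import all_classical all_reals all_analysis.
From mathcomp Require Import ring.

(** By the Riesz representation theorem, T x = t <x, w> u with t > 0 and u, w
    unit vectors; then ||T|| = t.  Computing the trace in an orthonormal basis
    containing u gives tr T = t <u, w>, so u and w are orthogonal.  Hence
    T = t E_12 and T^* = t E_21 for matrix units E_ij, and every word of length
    n in T and T^* is either 0 or some t^n E_ij.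
    If t = 1, the nonzero elements of the semigroup are the four E_ij, and any
    of them generates the others, so the semigroup is simple.  A simple
    selfadjoint semigroup is an SI semigroup.  Finally, if the semigroup is SI,
    the ideal generated by T contains T^*, a word of length 1, although its
    nonzero elements other than T are t^n E_ij with n >= 2; thus t = t^n and
    t = 1. *)

Set Implicit Arguments.
Unset Strict Implicit.
Unset Printing Implicit Defensive.

Import Order.TTheory GRing.Theory Num.Theory.
Import numFieldNormedType.Exports.

Local Open Scope complex_scope.
Local Open Scope classical_set_scope.
Local Open Scope ring_scope.

Lemma normr_small_eq0 (F : numFieldType) (a C : F) :
  (forall e, 0 < e -> `|a| <= C * e) -> a = 0.
Proof.
move=> small; apply/eqP; apply: contraT => a0.
have Ca : `|a| <= C by rewrite -[C]mulr1; exact: small.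
have C0 : 0 < C by apply: lt_le_trans Ca; rewrite normr_gt0.
(* A nonzero a would satisfy |a| <= |a|/2, by taking e = |a|/(2C). *)
have /small : 0 < `|a| / (C + C) by rewrite divr_gt0 ?normr_gt0 ?addr_gt0.
have -> : C * (`|a| / (C + C)) = `|a| / 2.
  by field; rewrite lt0r_neq0 // addr_gt0.
rewrite ler_pdivlMr // mulr_natr mulr2n gerDl normr_le0.
by rewrite (negbTE a0).
Qed.

(** * Inner product identities and the Cauchy-Schwarz inequality *)

Section inner_product.
Variables (R : realType) (H : hilbertType R).
Implicit Types (x y z : H) (A B : H -> H).
Local Notation C := R[i].

Lemma innerDl x y z : inner (x + y) z = inner x z + inner y z.
Proof. exact: linearDl. Qed.

Lemma innerDr x y z : inner z (x + y) = inner z x + inner z y.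
Proof. exact: linearDr. Qed.

Lemma innerZl (c : C) x y : inner (c *: x) y = c * inner x y.
Proof. exact: linearZl_LR. Qed.

Lemma innerZr (c : C) x y : inner x (c *: y) = c^* * inner x y.
Proof. exact: linearZr_LR. Qed.

Lemma innerBl x y z : inner (x - y) z = inner x z - inner y z.
Proof. exact: linearBl. Qed.

Lemma innerBr x y z : inner z (x - y) = inner z x - inner z y.
Proof. exact: linearBr. Qed.

Lemma inner0l x : inner 0 x = 0. Proof. exact: linear0l. Qed.

Lemma inner0r x : inner x 0 = 0. Proof. exact: linear0r. Qed.

Lemma innerC x y : inner x y = (inner y x)^*.
Proof. by rewrite hermC expr0 mul1r. Qed.

Lemma inner_ge0 x : 0 <= inner x x.
Proof. by rewrite inner_norm exprn_ge0. Qed.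

Lemma inner_eq0 x : (inner x x == 0) = (x == 0).
Proof. by rewrite inner_norm expf_eq0 normr_eq0. Qed.

Lemma inner_gt0 x : (0 < inner x x) = (x != 0).
Proof. by rewrite lt_def inner_eq0 inner_ge0 andbT. Qed.

(** Pythagoras for the residual of x after projection onto y. Its nonnegativity is Cauchy-Schwarz; a
    sharper lower bound yields orthogonality in the Riesz argument. *)
Lemma inner_proj x y : y != 0 ->
  inner (x - (inner x y / inner y y) *: y) (x - (inner x y / inner y y) *: y)
  = inner x x - `|inner x y| ^+ 2 / inner y y.
Proof.
move=> y0; have yy : inner y y != 0 by rewrite inner_eq0.
rewrite innerBl !innerBr !innerZl !innerZr normCK rmorphM fmorphV /=.
rewrite -!(innerC y).
by field.
Qed.

Lemma normr_inner_le x y : `|inner x y| <= `|x| * `|y|.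
Proof.
have [->|y0] := eqVneq y 0; first by rewrite inner0r !normr0 mulr0.
rewrite -(@ler_pXn2r _ 2) ?nnegrE ?mulr_ge0// exprMn -!inner_norm.
by rewrite -ler_pdivrMr ?inner_gt0// -subr_ge0 -inner_proj// inner_ge0.
Qed.

Lemma inner_parallelogram x y :
  inner (x - y) (x - y) =
  2 * inner x x + 2 * inner y y - 4 * inner (2^-1 *: (x + y)) (2^-1 *: (x + y)).
Proof.
rewrite !innerZl !innerZr fmorphV /= conjC_nat !innerBl !innerBr !innerDl.
rewrite !innerDr.
by field.
Qed.

Lemma inner_injr x y : (forall z, inner z x = inner z y) -> x = y.
Proof.
by move=> xy; apply/eqP; rewrite -subr_eq0 -inner_eq0 innerBr xy subrr.
Qed.

Lemma normr_unitP x : (inner x x = 1) <-> (`|x| = 1).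
Proof.
rewrite inner_norm; split=> [/eqP|->]; last by rewrite expr1n.
by rewrite sqrp_eq1 // => /eqP.
Qed.

Lemma inner_normalized x : x != 0 ->
  inner (`|x|^-1 *: x) (`|x|^-1 *: x) = 1.
Proof.
move=> x0; rewrite innerZl innerZr fmorphV /= geC0_conj // inner_norm.
by field; rewrite normr_eq0.
Qed.

(** [R[i]] is only partially ordered, so the infimum is taken in [R] over real parts; inner x x is
    real, so nothing is lost. *)
Lemma inner_inf (P : set H) : P !=set0 -> exists d : C,
  (forall x, P x -> d <= inner x x) /\
  (forall e, 0 < e -> exists2 x, P x & inner x x < d + e).
Proof.
move=> [x0 Px0].
have innerE x : inner x x = (complex.Re (inner x x))%:C.
  by rewrite RRe_real // ger0_real // inner_ge0.
pose E : set R := [set complex.Re (inner x x) | x in P].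
have lbE : lbound E 0.
  by move=> _ [x Px <-]; rewrite -lecR -innerE inner_ge0.
have iE : has_inf E by split; [exists (complex.Re (inner x0 x0)), x0|exists 0].
exists (inf E)%:C; split=> [x Px|e e0].
  by rewrite innerE lecR; apply: ge_inf; [exists 0|exists x].
have eE : e = (complex.Re e)%:C by rewrite RRe_real // gtr0_real.
have : 0 < complex.Re e by rewrite -ltcR -eE.
move=> /inf_adherent /(_ iE)[_ [x Px <-] xe]; exists x => //.
by rewrite innerE eE -rmorphD ltcR.
Qed.

(** * Riesz representation of bounded functionals *)

Section riesz.
Variable phi : {scalar H}.
Variable M : C.
Hypothesis phi_bounded : forall x, `|phi x| <= M * `|x|.

(* A point z of minimal norm on the hyperplane phi = 1 is orthogonal to the
   kernel of phi, so that phi = <_, z> / <z, z>.  The almost minimal points form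
   a Cauchy filter by the parallelogram law, and both phi z = 1 and the
   orthogonality of z are limits of approximate statements. *)
Lemma riesz_representation : exists v, forall x, phi x = inner x v.
Proof.
have [phi0|] := pselect (forall x, phi x = 0).
  by exists 0 => x; rewrite inner0r phi0.
move=> /existsNP[a /eqP a0].
have M0 : 0 <= M.
  have := le_trans (normr_ge0 _) (phi_bounded a).
  rewrite pmulr_lge0 // normr_gt0.
  by apply: contra_neq a0 => ->; rewrite linear0.
pose P : set H := [set x | phi x = 1].
have P1 : P !=set0.
  by exists ((phi a)^-1 *: a); rewrite /P /= linearZ /= mulVf.
have [d [dP Pd]] := inner_inf P1.
pose A (e : C) := [set x | P x /\ inner x x < d + e ^+ 2].
pose F := filter_from [set e : C | 0 < e] A.
have FF : ProperFilter F.
  apply: filter_from_proper; last first.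
    by move=> e /= e0; have [x Px xe] := Pd _ (exprn_gt0 2 e0); exists x.
  apply: filter_from_filter; first by exists 1 => /=.
  move=> e f /= e0 f0.
  wlog ef : e f e0 f0 / e <= f.
    move=> hw; have [ef|fe] := real_leP (gtr0_real e0) (gtr0_real f0).
      exact: hw.
    by have [g g0 gA] := hw _ _ f0 e0 (ltW fe); exists g; rewrite // setIC.
  exists e => // x [Px xe]; split; split => //; apply: lt_le_trans xe _.
  by rewrite lerD2l ler_pXn2r // nnegrE ltW.
have cF : cvg F.
  apply: cauchy_cvg; apply: cauchy_exP => e e0.
  (* The midpoint of x and y stays in [P], so the parallelogram law bounds |x - y|^2 by 4 (e/2)^2 =
     e^2. *)
  have e20 : 0 < e / 2 by rewrite divr_gt0.
  have [x Px xe] := Pd _ (exprn_gt0 2 e20); exists x.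
  exists (e / 2) => // y [Py ye].
  rewrite -ball_normE /=.
  rewrite -(@ltr_pXn2r _ 2) ?nnegrE ?(ltW e0) // -inner_norm.
  rewrite inner_parallelogram.
  have Pxy : P (2^-1 *: (x + y)).
    by rewrite /P /= linearZ linearD /= Px Py; field.
  apply: (@le_lt_trans _ _ (2 * inner x x + 2 * inner y y - 4 * d)).
    by rewrite lerD2l lerN2 ler_pM2l // dP.
  rewrite ltrBlDr.
  have -> : e ^+ 2 + 4 * d = 2 * (d + (e / 2) ^+ 2) + 2 * (d + (e / 2) ^+ 2).
    by field.
  by rewrite ltrD // ltr_pM2l.
have [z Fz] : exists z, F --> z by move/cvg_ex: cF.
have near_z e : 0 < e -> exists x, A e x /\ `|z - x| < e.
  move=> e0; have : F (A e `&` ball z e).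
    apply: filterI; first by exists e.
    exact/Fz/nbhsx_ballx.
  by move=> /filter_ex[x [Ax]]; rewrite -ball_normE /= => zx; exists x.
have phiz : phi z = 1.
  apply/subr0_eq; apply: (@normr_small_eq0 _ _ M) => e e0.
  have [x [[Px _] zx]] := near_z _ e0.
  rewrite -Px -linearB; apply: le_trans (phi_bounded _) _.
  by rewrite ler_wpM2l // ltW.
have z0 : z != 0.
  by apply/eqP => z0; move: phiz; rewrite z0 linear0 => /esym/eqP; rewrite oner_eq0.
have ort y : phi y = 0 -> inner z y = 0.
  move=> y0; have [->|ny] := eqVneq y 0; first by rewrite inner0r.
  apply: (@normr_small_eq0 _ _ (`|y| + `|y|)) => e e0.
  have [x [[Px xe] zx]] := near_z _ e0.
  rewrite -[z](subrK x) innerDl mulrDl.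
  apply: le_trans (ler_normD _ _) (lerD _ _).
    apply: le_trans (normr_inner_le _ _) _.
    by rewrite mulrC ler_wpM2l // ltW.
  (* Since y is in the kernel, subtracting from x its projection onto y stays in [P]. This lowers
     the squared norm by |<x, y>|^2 / <y, y>, hence by at most e^2. *)
  rewrite -(@ler_pXn2r _ 2) ?nnegrE ?mulr_ge0 ?(ltW e0) // exprMn -inner_norm.
  rewrite -ler_pdivrMl ?inner_gt0 // mulrC -(lerD2l d).
  have : P (x - (inner x y / inner y y) *: y).
    by rewrite /P /= linearB linearZ /= y0 mulr0 subr0.
  move=> /dP; rewrite inner_proj // lerBrDr => h.
  exact: le_trans h (ltW xe).
have zz : inner z z != 0 by rewrite inner_eq0.
exists ((inner z z)^-1 *: z) => x.
have : phi (x - phi x *: z) = 0.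
  by rewrite linearB linearZ /= phiz mulr1 subrr.
move=> /ort; rewrite innerC => /(congr1 Num.conj); rewrite conjCK rmorph0.
rewrite innerBl innerZl => /eqP; rewrite subr_eq0 => /eqP xz.
rewrite innerZr fmorphV /= -innerC xz.
by field.
Qed.

End riesz.

Lemma orthonormal_basis_extend (E : set H) : orthonormal_set E ->
  exists2 B, orthonormal_basis B & E `<=` B.
Proof.
(* Taking the union with [E] inside [P] lets the empty chain satisfy Zorn's condition too. *)
move=> oE; pose P := [set B | orthonormal_set (E `|` B)].
have [F PF totF|B [PB maxB]] := @Zorn_bigcup H P; last first.
  exists (E `|` B); last exact: subsetUl.
  split=> // E' oE' BE'; apply: contrapT => neqE'.
  have EE' : E `<=` E' by apply: subset_trans BE'; exact: subsetUl.
  apply: (maxB E'); last by rewrite /P /= setUidr.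
  split; first by apply: subset_trans BE'; exact: subsetUr.
  move=> E'B; apply: neqE'; apply/seteqP; by split=> // x /E'B; right.
split=> [e [Ee|[X FX Xe]]|e f].
- exact: oE.1.
- by apply: (PF X FX).1; right.
move=> [Ee|[X FX Xe]] [Ef|[Y FY Yf]].
- exact: oE.2.
- by apply: (PF Y FY).2; [left|right].
- by apply: (PF X FX).2; [right|left].
have [XY|YX] := totF _ _ FX FY.
- by apply: (PF Y FY).2; right => //; exact: XY.
- by apply: (PF X FX).2; right => //; exact: YX.
Qed.

(** * Rank one operators, adjoints and operator norm *)

Definition rk1 (c : C) (a b : H) : H -> H := fun x => (c * inner x b) *: a.

Lemma rk1_comp c d a b a' b' :
  rk1 c a b \o rk1 d a' b' = rk1 (c * d * inner a' b) a b'.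
Proof.
by apply/funext => x; rewrite /rk1 /= innerZl; congr (_ *: _); ring.
Qed.

Lemma rk10 a b : rk1 0 a b = fun=> 0.
Proof. by apply/funext => x; rewrite /rk1 mul0r scale0r. Qed.

Lemma bounded_rk1 c a b : bounded_op (rk1 c a b).
Proof.
split=> [k x y|].
  by rewrite /rk1 innerDl innerZl scalerA -scalerDl; congr (_ *: _); ring.
exists (`|c| * `|b| * `|a|) => x.
rewrite normrZ normrM [leRHS]mulrAC ler_wpM2r // -mulrA ler_wpM2l //.
rewrite [leRHS]mulrC.
exact: normr_inner_le.
Qed.

(** The relation from which [adjoint] chooses; unlike the choice, it passes directly through
    composition. *)
Definition is_adjoint (A B : H -> H) :=
  bounded_op B /\ forall x y, inner (A x) y = inner x (B y).

Lemma adjointE A B : is_adjoint A B -> adjoint A = B.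
Proof.
move=> AB; apply: get_unique => // B' AB'; apply/funext => y.
by apply: inner_injr => z; rewrite -AB'.2 AB.2.
Qed.

Lemma is_adjoint_rk1 c a b : is_adjoint (rk1 c a b) (rk1 c^* b a).
Proof.
split=> [|x y]; first exact: bounded_rk1.
by rewrite /rk1 innerZl innerZr rmorphM /= conjCK -innerC; ring.
Qed.

Lemma bounded_comp (A B : H -> H) :
  bounded_op A -> bounded_op B -> bounded_op (A \o B).
Proof.
move=> [lA [M hM]] [lB [N hN]]; split=> [k x y|] /=; first by rewrite lB lA.
(* [bounded_op] puts no sign condition on its constant, so the constant is replaced by its
   modulus. *)
have bound_norm L (D : H -> H) x : `|D x| <= L * `|x| -> `|D x| <= `|L| * `|x|.
  move=> h; apply: (le_trans h).
  by rewrite -(ger0_norm (le_trans _ h)) // normrM normr_id.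
exists (`|M| * `|N|) => x /=; apply: le_trans (bound_norm _ _ _ (hM _)) _.
by rewrite -mulrA ler_wpM2l // bound_norm.
Qed.

Lemma is_adjoint_comp (A A' B B' : H -> H) :
  is_adjoint A A' -> is_adjoint B B' -> is_adjoint (A \o B) (B' \o A').
Proof.
move=> [bA hA] [bB hB]; split=> [|x y /=]; first exact: bounded_comp.
by rewrite hA hB.
Qed.

(** Cauchy-Schwarz gives the upper bound, attained at b. *)
Lemma opnorm_rk1 (t : C) a b : 0 <= t -> inner a a = 1 -> inner b b = 1 ->
  (opnorm (rk1 t a b))%:C = t.
Proof.
move=> t0 /normr_unitP a1 /normr_unitP b1.
rewrite -[RHS]RRe_real ?ger0_real //; congr (_%:C).
have nT x : `|rk1 t a b x| = t * `|inner x b|.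
  by rewrite normrZ normrM a1 mulr1 ger0_norm.
have ubT : ubound [set complex.Re `|rk1 t a b x| | x in [set x | `|x| <= 1]]
    (complex.Re t).
  move=> _ [x /= x1 <-]; rewrite -lecR !RRe_real ?ger0_real // nT.
  rewrite ler_piMr //; apply: le_trans (normr_inner_le _ _) _.
  by rewrite b1 mulr1.
have inT : [set complex.Re `|rk1 t a b x| | x in [set x | `|x| <= 1]]
    (complex.Re t).
  by exists b => /=; rewrite ?b1 // nT inner_norm b1 expr1n normr1 mulr1.
apply/le_anti/andP; split; first by apply: ge_sup => //; exists (complex.Re t).
by apply: ub_le_sup => //; exists (complex.Re t).
Qed.

(** * Normal form of a rank one operator of trace zero *)

Lemma rank_one_trace0 (T : H -> H) :
  bounded_op T -> rank_one T -> has_trace T 0 ->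
  exists t u w, [/\ 0 < t, inner u u = 1, inner w w = 1, inner u w = 0 &
    T = rk1 t u w].
Proof.
move=> [lT [M bT]] [u0 u0n rT] trT.
have [u [u1 u0E]] : exists u, inner u u = 1 /\ u0 = `|u0| *: u.
  exists (`|u0|^-1 *: u0); split; first exact: inner_normalized.
  by rewrite scalerA divff ?normr_eq0 ?scale1r.
have nu : `|u| = 1 by apply/normr_unitP.
pose phi x := inner (T x) u.
have TE x : T x = phi x *: u.
  have : range T (T x) by exists x.
  rewrite rT /phi => -[c _ <-]; rewrite u0E !innerZl u1 mulr1 scalerA //.
have lphi : scalar phi.
  by move=> k x y; rewrite /phi lT innerDl innerZl.
pose phiL : {scalar H} := HB.pack phi (GRing.isLinear.Build _ _ _ _ phi lphi).
have bphi x : `|phiL x| <= M * `|x|.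
  apply: le_trans (bT x); rewrite -[leRHS]mulr1 -nu; exact: normr_inner_le.
have [v phiv] := riesz_representation bphi.
(* In an orthonormal basis containing u, only u contributes to the trace. *)
have uv : inner u v = 0.
  have ou : orthonormal_set [set u].
    by split=> [e ->//|e f -> ->]; rewrite eqxx.
  have [B oB uB] := orthonormal_basis_extend ou.
  apply: (@normr_small_eq0 _ _ 1) => e e0; rewrite mul1r ltW //.
  have [F0 [fF0 F0B F0e]] := trT _ oB _ e0.
  (* The partial sum over F0 with u adjoined already equals <u, v>, and it is within e of the trace
     0. *)
  have /F0e : finite_set (F0 `|` [set u]) by rewrite finite_setU.
  move=> /(_ (@subsetUl _ _ _)); rewrite subr0 => /(_ _).
  rewrite (_ : \sum_(_ \in _) _ = inner u v); first by apply; rewrite subUset.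
  rewrite (fsbigD1 u) //=; [|by rewrite finite_setU|by right].
  rewrite fsbig1 ?addr0; first by rewrite TE innerZl u1 mulr1 -phiv.
  move=> f [F0f /eqP fu]; rewrite TE innerZl oB.1.2 ?mulr0 //.
  - exact: uB.
  - by case: F0f => [/F0B//|->]; exact: uB.
  - by rewrite eq_sym.
have v0 : v != 0.
  apply: contra_neq u0n => v0.
  have [x _ <-] : range T u0 by rewrite rT; exists 1; rewrite ?scale1r.
  by rewrite TE [phi x]phiv v0 inner0r scale0r.
exists `|v|, u, (`|v|^-1 *: v); split=> //.
- by rewrite normr_gt0.
- exact: inner_normalized.
- by rewrite innerZr uv mulr0.
apply/funext => x; rewrite TE [phi x]phiv /rk1 innerZr fmorphV /= geC0_conj //.
by rewrite mulVKf ?normr_eq0.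
Qed.

End inner_product.

(** * The semigroup generated by t E_12 and t E_21 *)

Section two_by_two.
Variables (R : realType) (H : hilbertType R) (t : R[i]) (u w : H).
Hypotheses (t_gt0 : 0 < t) (u1 : inner u u = 1) (w1 : inner w w = 1).
Hypothesis uw : inner u w = 0.

Let e (i : bool) := if i then u else w.

Let inner_e i j : inner (e i) (e j) = (i == j)%:R.
Proof.
have wu : inner w u = 0 by rewrite innerC uw rmorph0.
by case: i; case: j.
Qed.

Let T := rk1 t u w.
Let T' := rk1 t w u.
Let S := generated_semigroup [set T; T'].

(* The matrix unit E_ij on the span of u and w, scaled by c. *)
Let m (c : R[i]) i j := rk1 c (e i) (e j).

Let m_comp c d i j k l : m c i j \o m d k l = m (c * d * (k == j)%:R) i l.
Proof. by rewrite /m rk1_comp inner_e. Qed.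

Let m_inj c d i j k l : d != 0 -> m c i j = m d k l ->
  [/\ c = d, i = k & j = l].
Proof.
move=> d0 /(congr1 (fun A => A (e l))).
rewrite /m /rk1 !inner_e eqxx mulr1 => /(congr1 (inner ^~ (e k))).
rewrite !innerZl !inner_e eqxx mulr1.
case: eqP => [->|_]; case: eqP => [->|_]; rewrite ?mulr1 ?mulr0 ?mul0r //.
all: by move=> /esym/eqP; rewrite (negbTE d0).
Qed.

(** The bound [k] records word length from below, so it adds up under composition. *)
Let power_unit (k : nat) A :=
  A = (fun=> 0) \/ exists n i j, (k <= n)%N /\ A = m (t ^+ n) i j.

Let power_unit_comp k l A B :
  power_unit k A -> power_unit l B -> power_unit (k + l) (A \o B).
Proof.
move=> [->|[n [i [j [kn ->]]]]]; first by left.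
move=> [->|[n' [i' [j' [ln ->]]]]].
  by left; apply/funext => x; rewrite /m /rk1 /= inner0l mulr0 scale0r.
rewrite m_comp; have [_|_] := eqP; last by left; rewrite mulr0 /m rk10.
right; exists (n + n')%N, i, j'; rewrite mulr1 exprD; split=> //.
exact: leq_add.
Qed.

Let S_power_unit A : S A -> power_unit 1 A.
Proof.
elim=> [_ [->|->]|B D _ hB _ hD].
- by right; exists 1%N, true, false.
- by right; exists 1%N, false, true.
have [->|[n [i [j [n2 ->]]]]] := power_unit_comp hB hD; first by left.
by right; exists n, i, j; split=> //; exact: ltnW.
Qed.

Let adj_T : adjoint T = T'.
Proof.
by rewrite (adjointE (is_adjoint_rk1 _ _ _)) geC0_conj // ltW.
Qed.

Let S_adjoint A : S A -> exists2 B, S B & is_adjoint A B.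
Proof.
have tt : t^* = t by rewrite geC0_conj // ltW.
elim=> [_ [->|->]|B D _ [B' SB' hB] _ [D' SD' hD]].
- exists T'; first by apply: gen_base; right.
  by have := is_adjoint_rk1 t u w; rewrite tt.
- exists T; first by apply: gen_base; left.
  by have := is_adjoint_rk1 t w u; rewrite tt.
exists (D' \o B'); first exact: gen_comp.
exact: is_adjoint_comp.
Qed.

Lemma simple_SI : simple_semigroup S -> SI_semigroup S.
Proof.
move=> simS J idJ _ [A JA <-].
have [B SB AB] := S_adjoint (idJ.1 _ JA).
(* The zero operator is its own adjoint; a nonzero A forces J = S, which contains B. *)
rewrite (adjointE AB); have [A0|A0] := pselect (A = fun=> 0).
  suff -> : B = A by [].
  rewrite -(adjointE AB) A0 -{1}(rk10 0 0) (adjointE (is_adjoint_rk1 _ _ _)).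
  by rewrite rmorph0 rk10.
by rewrite (simS J idJ) //; exists A.
Qed.

(* Besides T, the ideal generated by T only contains words of length at
   least 2, hence multiples t ^+ n of matrix units with n >= 2. *)
Lemma SI_scale1 : SI_semigroup S -> t = 1.
Proof.
move=> SIS; pose J := [set A | S A /\ (A = T \/ power_unit 2 A)].
have ST : S T by apply: gen_base; left.
have J1 A : J A -> power_unit 1 A by move=> [/S_power_unit].
have idJ : ideal S J.
  split=> [A []//|A X JA SX]; have [SA _] := JA.
  by split; (split; [exact: gen_comp|right]);
     apply: (@power_unit_comp 1 1); first [exact: J1|exact: S_power_unit].
have JT : J T by split=> //; left.
have : J T' by apply: (SIS J idJ); exists T.
have t0 : t != 0 by rewrite gt_eqF.
(* T' differs from T by its indices and is nonzero, which leaves T' = t^n E_ij with n >= 2. *)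
move=> [_ []]; first by move=> /(@m_inj _ _ false true true false t0)[].
case=> [T'0|[n [i [j [n2 T'E]]]]].
  have : m 0 false true = m t false true by rewrite {1}/m rk10 -T'0.
  by move=> /m_inj -/(_ t0)[/esym/eqP]; rewrite (negbTE t0).
have : m (t ^+ n) i j = m t false true by rewrite -T'E.
move=> /m_inj -/(_ t0)[+ _ _]; case: n n2 {T'E} => // n n1.
rewrite exprS -[RHS]mulr1 => /(mulfI t0) /eqP.
by rewrite pexpr_eq1 ?ltW // => /eqP.
Qed.

(** All four matrix units lie in S, the diagonal ones as products of the two generators. Then E_kl =
    E_ki E_ij E_jl puts all of them in any ideal containing one E_ij. *)
Lemma scale1_simple : t = 1 -> simple_semigroup S.
Proof.
move=> t1 J idJ [A JA A0].
have S1 i j : S (m 1 i j).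
  have Sod i' : S (m 1 i' (~~ i')).
    by apply: gen_base; rewrite /T /T' t1; case: i'; [left|right].
  have [->|] := eqVneq i j; last by case: i; case: j => // _; exact: Sod.
  have -> : m 1 j j = m 1 j (~~ j) \o m 1 (~~ j) (~~ ~~ j).
    by rewrite m_comp eqxx !mulr1 negbK.
  by apply: gen_comp; exact: Sod.
have [A_|[n [i [j [_ AE]]]]] := S_power_unit (idJ.1 _ JA); first by [].
have J1 k l : J (m 1 k l).
  have -> : m 1 k l = (m 1 k i \o A) \o m 1 j l.
    by rewrite AE t1 expr1n !m_comp !eqxx !mulr1.
  apply: (idJ.2 _ _ _ (S1 _ _)).2.
  exact: (idJ.2 _ _ JA (S1 _ _)).1.
apply/seteqP; split; first exact: idJ.1.
move=> B; elim=> [_ [->|->]|D D' _ JD SD' _].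
- by rewrite /T t1; exact: (J1 true false).
- by rewrite /T' t1; exact: (J1 false true).
exact: (idJ.2 _ _ JD SD').2.
Qed.

(** The cycle SI, then norm one, then simple, then SI gives both equivalences. *)
Lemma SI_opnorm_simple :
  (SI_semigroup (generated_semigroup [set T; adjoint T]) <-> opnorm T = 1) /\
  (opnorm T = 1 <-> simple_semigroup (generated_semigroup [set T; adjoint T])).
Proof.
rewrite adj_T -/S.
have nT : opnorm T = 1 <-> t = 1.
  have TE := opnorm_rk1 (ltW t_gt0) u1 w1.
  by rewrite -TE; split=> [->//|/complexI].
have h1 : opnorm T = 1 -> simple_semigroup S by move/nT/scale1_simple.
have h2 : SI_semigroup S -> opnorm T = 1 by move/SI_scale1/nT.
by split; split=> //; [move/h1/simple_SI|move/simple_SI/h2].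
Qed.

End two_by_two.

Theorem theorem3p9 (R : realType) (H : hilbertType R) (T : H -> H)
    (hT : bounded_op T) (hrank : rank_one T) (htr : has_trace T 0) :
  (SI_semigroup (generated_semigroup [set T; adjoint T]) <-> opnorm T = 1) /\
  (opnorm T = 1 <-> simple_semigroup (generated_semigroup [set T; adjoint T])).
Proof.
have [t [u [w [t0 u1 w1 uw ->]]]] := rank_one_trace0 hT hrank htr.
exact: SI_opnorm_simple.
Qed.
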